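(* Let $E$ be a sequence space with a complete and order continuous lattice norm and let $(T_t)_{t\in(0,\infty)}$ be a positive one-parameter semigroup on $E$ such that $t\mapsto (T_te^i)_j$ is measurable on $(0,\infty)$ for all $i,j\in\mathbb{N}$. Then, for every $i,j\in\mathbb{N}$, either $(T_te^i)_j>0$ for all $t>0$, or $(T_te^i)_j=0$ for all $t>0$.
   Context: Let $\ell^0$ be the vector lattice of all real sequences $(x_n)_{n\in\mathbb{N}}$ with the component-wise ordering. For $k\in\mathbb{N}$ let $e^k=(\mathbf{1}_{\{k\}}(n))_{n\in\mathbb{N}}$ be the $k$-th unit vector. A sequence space is a sublattice of $\ell^0$ (a linear subspace closed under the lattice operations of $\ell^0$) that contains all unit vectors $e^k$, $k\in\mathbb{N}$. For a sequence space $E$ let $E_+=\{x\in E: x_n\ge 0 \text{ for all } n\in\mathbb{N}\}$. A linear operator $T\colon E\to E$ is positive if $TE_+\subseteq E_+$. A sequence $(x^k)\subseteq E$ is order convergent to $x\in E$ if it is order bounded in $E$ (i.e. there is $y\in E$ with $|x^k|\le y$ for all $k$) and $x^k_n\to x_n$ as $k\to\infty$ for all $n\in\mathbb{N}$. A norm on a vector lattice is a lattice norm if $\|x\|\le\|y\|$ whenever $|x|\le|y|$. A lattice norm on a sequence space is order continuous if every order convergent sequence converges in norm. A family of linear operators $(T_t)_{t\in(0,\infty)}$ on a vector space is a (one-parameter operator) semigroup if $T_{t+s}=T_tT_s$ for all $t,s>0$; it is positive if every $T_t$ is positive. *)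

(* Defs.v *)
From HB Require Import structures.
From mathcomp Require Import all_boot all_order all_algebra.
From mathcomp Require Import all_classical all_reals all_analysis.

Set Implicit Arguments.
Unset Strict Implicit.
Unset Printing Implicit Defensive.

Import Order.TTheory GRing.Theory Num.Theory.
Import numFieldNormedType.Exports.

Local Open Scope classical_set_scope.
Local Open Scope ring_scope.

Definition unit_vec (R : realType) (k : nat) : nat -> R :=
  fun n => (n == k)%:R.

(* S is a sublattice of the vector lattice of all real sequences and contains
   the unit vectors; \max and \min are the componentwise lattice operations. *)
Record sequence_space (R : realType) (S : {pred nat -> R}) : Prop := {
  seqsp_submod : submod_closed S;
  seqsp_max : forall x y, x \in S -> y \in S -> (x \max y) \in S;
  seqsp_min : forall x y, x \in S -> y \in S -> (x \min y) \in S;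
  seqsp_unit : forall k, unit_vec R k \in S
}.

(* An E : banachSeqType S is the linear subspace {x | x \in S} of all real
   sequences (\val : E -> (nat -> R) is the inclusion, as for every subType),
   endowed with a complete norm.  The topology of E is that of the norm. *)
#[short(type="banachSeqType")]
HB.structure Definition BanachSeq (R : realType) (S : {pred nat -> R}) :=
  { E of @GRing.SubLmodule R (nat -> R) S E & CompleteNormedModule R E }.

Section BanachSeqTheory.
Variables (R : realType) (S : {pred nat -> R}) (E : banachSeqType S).

Definition seq_coord (x : E) (n : nat) : R := \val x n.

Definition seq_unit (hS : sequence_space S) (k : nat) : E :=
  Sub (unit_vec R k) (seqsp_unit hS k).

Definition lattice_norm : Prop :=
  forall x y : E, (forall n, `|seq_coord x n| <= `|seq_coord y n|) -> `|x| <= `|y|.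

Definition order_cvg (x : nat -> E) (l : E) : Prop :=
  (exists y : E, forall k n, `|seq_coord (x k) n| <= seq_coord y n) /\
  (forall n, (fun k => seq_coord (x k) n) @ \oo --> seq_coord l n).

Definition order_continuous_norm : Prop :=
  forall (x : nat -> E) (l : E), order_cvg x l -> x @ \oo --> l.

Definition positive_operator (T : E -> E) : Prop :=
  forall x : E, (forall n, 0 <= seq_coord x n) -> forall n, 0 <= seq_coord (T x) n.

(* The values of T outside (0, +oo) are irrelevant here and below. *)
Definition operator_semigroup (T : R -> {linear E -> E}) : Prop :=
  forall t s : R, 0 < t -> 0 < s -> T (t + s) =1 T t \o T s.

Definition positive_semigroup (T : R -> {linear E -> E}) : Prop :=
  operator_semigroup T /\ forall t, 0 < t -> positive_operator (T t).

End BanachSeqTheory.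

Arguments seq_unit {R S} E hS k.
Arguments lattice_norm {R S} E.
Arguments order_continuous_norm {R S} E.

(* lebesgueR is R with the sigma-algebra of Lebesgue measurable sets, on which
   completed_lebesgue_measure is defined; plain R has the Borel sigma-algebra. *)
Notation lebesgueR R := (caratheodory_type ((wlength (@idfun R))^*)%mu).

Definition lebesgue_measurable_fun (R : realType) (D : set R) (f : R -> R) :=
  measurable_fun (D : set (lebesgueR R)) (f : lebesgueR R -> R).

(* Main.v *)
Require Import Defs.
From HB Require Import structures.
From mathcomp Require Import all_boot all_order all_algebra.
From mathcomp Require Import all_classical all_reals all_analysis.
From mathcomp Require Import measurable_realfun.
From mathcomp Require Import lra ring zify finmap.

Import Order.TTheory GRing.Theory Num.Theory.
Import numFieldNormedType.Exports.

Local Open Scope classical_set_scope.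
Local Open Scope ring_scope.

(** Write p i j t for the j-th coordinate of T_t e_i. Because the norm is
    complete and order continuous, each T_t can be applied term by term to the
    expansion of a positive vector along the unit vectors [positive_coord_sum].
    So p is a semigroup of infinite matrices with non-negative entries
    [semigroup_matrix], and the theorem is Lévy's dichotomy for such a
    semigroup [matrix_semigroup_dichotomy].

    It helps to think of paths. If p i j tau > 0, the numbers
    p i k s * p k j (tau - s) / p i j tau are the probabilities that a random
    path from i to j of duration tau is in state k at time s. Three facts are
    combined.

    If p i j does not vanish identically, it is positive at arbitrarily small
    times [gt0_arbitrarily_early]. Let a(k) be the first time at which k can be
    reached from i. Along a path, a(X_s) climbs at speed at most one and starts
    at 0, so if it ends at a(j) > 0 it has to spend an amount of time at least
    a(j) at levels outside any given finite set of levels. But up to a small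
    amount of time the path stays in finitely many states, hence at finitely
    many levels. This is carried out on a mesh, so that only the marginals of
    the path at one time and the semigroup law are needed; the offset of the
    mesh is averaged to pass from mesh points to Lebesgue measure, which is
    where measurability enters.

    Between i and j there is a state k with a loop, p k k d > 0 for some d > 0
    [recurrent_intermediate_state]. Indeed some k is visited at a non-null set
    of times, while for a state without loops the visits at distinct times are
    disjoint events, so that only countably many of them have positive weight.

    If k has a loop, then p k k is positive everywhere [loop_gt0]: by
    Steinhaus' theorem it is positive on a neighbourhood of each of its points
    of positivity, the first fact provides such points and loops of arbitrarily
    small duration, and durations of loops add up.

    A path from i to j of any duration t is now obtained from a shorter one that
    passes through such a k by inserting a loop at k of the missing
    duration. *)

(** * Lebesgue measure on the line *)

Section LebesgueMeasure.
Context {R : realType}.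
Notation mu := (@completed_lebesgue_measure R).
Local Open Scope ereal_scope.

Lemma lebesgue_measurable_itv (i : interval R) :
  measurable ([set` i] : set (lebesgueR R)).
Proof. by apply: sub_caratheodory; exact: measurable_itv. Qed.

Lemma mu_le (A B : set R) : A `<=` B -> mu A <= mu B.
Proof. exact: (le_outer_measure (wlength idfun)^*%mu). Qed.

Lemma mu_bigcup_le (A : nat -> set R) :
  mu (\bigcup_k A k) <= \sum_(k <oo) mu (A k).
Proof. exact: (outer_measure_sigma_subadditive (wlength idfun)^*%mu). Qed.

Lemma mu_itv (i : interval R) :
  mu [set` i] = if i.2 > i.1 then (i.2 : \bar R) - i.1 else 0.
Proof. exact: lebesgue_measure_itv. Qed.

Lemma countable_mu0 (A : set R) : countable A -> mu A = 0%E.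
Proof. exact: countable_lebesgue_measure0. Qed.

(** The outer measure is an infimum over covers by half-open intervals; the
    reflection of such an interval is half-open on the other side and has the
    same length. This gives one inequality, and a reflection is its own
    inverse. *)
Lemma mu_reflect (c : R) (A : set R) : mu ((fun x => (c - x)%R) @^-1` A) = mu A.
Proof.
have le (X : set R) : mu ((fun x => (c - x)%R) @^-1` X) <= mu X.
  apply: le_ereal_inf_tmp => _ [B [mB XB] <-].
  apply: (@le_trans _ _ (\sum_(k <oo) mu ((fun x => (c - x)%R) @^-1` B k))).
    apply: (@le_trans _ _ (mu (\bigcup_k ((fun x => (c - x)%R) @^-1` B k)))).
      apply: mu_le => x /= /XB[k _ Bk].
      by exists k.
    exact: mu_bigcup_le.
  apply: lee_nneseries => // k _; have [[a b] _ <-] := mB k.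
  rewrite (_ : _ @^-1` _ = `[(c - b)%R, (c - a)%R[%classic); last first.
    apply/seteqP; split => x /=; rewrite !in_itv/= => /andP[? ?].
      by apply/andP; split; lra.
    by apply/andP; split; lra.
  rewrite [leRHS](_ : _ = wlength idfun `]a, b]%classic) //.
  rewrite mu_itv wlength_itv /= !lte_fin.
  by case: ifPn => h1; case: ifPn => h2; rewrite -?EFinB ?lee_fin//; lra.
apply/eqP; rewrite eq_le le /=.
have := le ((fun x => (c - x)%R) @^-1` A).
rewrite -comp_preimage [X in mu X](_ : _ = A)//.
by apply/seteqP; split => x /=; rewrite subKr.
Qed.

(** Carathéodory measurability is defined from the outer measure alone, hence
    inherits its symmetries. *)
Lemma measurable_reflect (c : R) (A : set R) :
  measurable (A : set (lebesgueR R)) ->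
  measurable ((fun x => (c - x)%R) @^-1` A : set (lebesgueR R)).
Proof.
move=> mA; set r := (fun x : R => (c - x)%R).
have rA : r @^-1` (r @^-1` A) = A.
  by apply/seteqP; split => x /=; rewrite /r subKr.
have {}mA : caratheodory_measurable mu A by exact: mA.
suff : caratheodory_measurable mu (r @^-1` A) by [].
move=> X; rewrite -(mu_reflect c X) -(mu_reflect c (X `&` _)).
rewrite -(mu_reflect c (X `&` ~` _)) !preimage_setI preimage_setC rA.
rewrite -[in RHS](_ : (~` A) = r @^-1` (r @^-1` (~` A))); first exact: mA.
by apply/seteqP; split => x /=; rewrite /r subKr.
Qed.

Lemma shift_reflectE (c : R) (A : set R) : (fun x => (x + c)%R) @^-1` A =
  (fun x => (0 - x)%R) @^-1` ((fun x => (c - x)%R) @^-1` A).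
Proof. by apply/seteqP; split => x /=; rewrite sub0r opprK addrC. Qed.

Lemma mu_shift (c : R) (A : set R) : mu ((fun x => (x + c)%R) @^-1` A) = mu A.
Proof. by rewrite shift_reflectE !mu_reflect. Qed.

Lemma measurable_shift (c : R) (A : set R) :
  measurable (A : set (lebesgueR R)) ->
  measurable ((fun x => (x + c)%R) @^-1` A : set (lebesgueR R)).
Proof. by rewrite shift_reflectE => ?; do 2 apply: measurable_reflect. Qed.

(** The offset-averaging principle for meshes: as the offset s runs through
    ]0, h[, the points s + m h run through disjoint intervals, so integrating
    over s the number of those that fall in U gives at most the measure of U. *)
Lemma mesh_count_le_measure (U : set R) (h : R) (n N : nat) :
  measurable (U : set (lebesgueR R)) -> (0 < h)%R ->
  (forall s, (0 < s < h)%R -> (N <= \sum_(m < n) ((s + m%:R * h)%R \in U))%N) ->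
  (N%:R * h)%:E <= mu U.
Proof.
move=> mU h0 HN.
pose I : set (lebesgueR R) := `]0%R, h[%classic.
have mI : measurable I by exact: lebesgue_measurable_itv.
pose V (m : nat) : set (lebesgueR R) := (fun x => (x + m%:R * h)%R) @^-1` U.
have mV m : measurable (V m) by exact: measurable_shift.
pose C (m : nat) : set (lebesgueR R) := U `&` `](m%:R * h)%R, (m.+1%:R * h)%R[.
have mC m : measurable (C m).
  by apply: measurableI => //; exact: lebesgue_measurable_itv.
have -> : (N%:R * h)%:E = \int[mu]_(x in I) (N%:R)%:E.
  rewrite integral_cst// [X in _ * X](_ : _ = h%:E) ?EFinM//.
  by rewrite [LHS]mu_itv/= lte_fin h0 oppr0 adde0.
apply: (@le_trans _ _ (\int[mu]_(x in I) \sum_(m < n) (\1_(V m) x)%:E)).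
  apply: ge0_le_integral => //.
  - apply: emeasurable_sum => m.
    by apply/measurable_EFinP; exact: measurable_indic.
  - move=> x; rewrite /I /= in_itv/= => /HN; rewrite sumEFin lee_fin => Nx.
    rewrite (_ : (\sum_(i < n) _)%R =
      (\sum_(m < n) ((x + m%:R * h)%R \in U))%:R%R) ?ler_nat//.
    rewrite natr_sum; apply: eq_bigr => m _; rewrite indicE.
    by congr (_%:R%R); congr nat_of_bool; apply/idP/idP; rewrite !inE.
rewrite ge0_integral_sum//; last first.
  by move=> m; apply/measurable_EFinP; exact: measurable_indic.
under eq_bigr do rewrite integral_indic//.
have -> : \sum_(i < n) mu (V i `&` I) = \sum_(i < n) mu (C i).
  apply: eq_bigr => m _; rewrite -(mu_shift (m%:R * h) (C m)); congr mu.
  apply/seteqP; split => x; rewrite /I /C /V/= !in_itv/= -natr1 mulrDl mul1r.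
    by move=> [Ux /andP[x0 xh]]; split => //; apply/andP; split; lra.
  by move=> [Ux /andP[x0 xh]]; split => //; apply/andP; split; lra.
rewrite -(@measure_semi_additive_ord_I _ _ _ mu C n)//; last 2 first.
- apply/trivIsetP => a b _ _ /eqP ab; rewrite -subset0 => x [[_ ax] [_ bx]].
  move: ax bx; rewrite /= !in_itv/= => /andP[a1 a2] /andP[b1 b2].
  have : (a%:R * h < b.+1%:R * h)%R by lra.
  have : (b%:R * h < a.+1%:R * h)%R by lra.
  rewrite !ltr_pM2r// !ltr_nat !ltnS => ? ?.
  by apply: ab; apply/eqP; rewrite eqn_leq; apply/andP.
- exact: bigsetU_measurable.
apply: mu_le.
by move=> x; rewrite -bigcup_mkord => -[? _ []].
Qed.

(** Otherwise every cover of B by intervals would have total length at least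
    4/3 of the measure of B, although that measure is the infimum of such total
    lengths. *)
Lemma interval_of_high_density (B : set R) : 0 < mu B < +oo ->
  exists a b : R, (a < b)%R /\
    (3%:R / 4%:R * (b - a))%:E < mu (B `&` `]a, b]%classic).
Proof.
move=> /andP[B0 Boo].
have fB : mu B \is a fin_num by rewrite ge0_fin_numE// ltW.
set m := fine (mu B); have mE : mu B = m%:E by rewrite fineK.
have m0 : (0 < m)%R by rewrite -lte_fin -mE.
have m30 : (0 < m / 3%:R)%R by rewrite divr_gt0.
have [_ [A [mA BA] <-] ltA] := lb_ereal_inf_adherent m30 fB.
apply: contrapT => /forallNP nab.
have le k : mu (B `&` A k) <= (3%:R / 4%:R)%:E * wlength idfun (A k).
  have [[a b] _ <-] := mA k; rewrite wlength_itv/= lte_fin.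
  case: ifPn => ab.
    have /forallNP/(_ b)/not_andP[//|/negP] := nab a.
    by rewrite -leNgt.
  by rewrite set_itv_ge ?bnd_simp// setI0 measure0 mule0.
suff : mu B < mu B by rewrite ltxx.
apply: (@le_lt_trans _ _ (\sum_(k <oo) mu (B `&` A k))).
  apply: (@le_trans _ _ (mu (\bigcup_k (B `&` A k)))).
    rewrite -setI_bigcupr; apply: mu_le.
    by move=> x Bx; split => //; exact: BA.
  exact: mu_bigcup_le.
apply: (@le_lt_trans _ _ (\sum_(k <oo) (3%:R / 4%:R)%:E * wlength idfun (A k))).
  exact: lee_nneseries.
rewrite nneseriesZl//.
apply: (@lt_le_trans _ _ ((3%:R / 4%:R)%:E * (mu B + (m / 3)%:E))).
  by rewrite lte_pmul2l// lte_fin divr_gt0.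
by rewrite mE -EFinD -EFinM lee_fin; lra.
Qed.

(** Steinhaus' theorem. Where B has density above 3/4 in an interval of length
    l, the parts of B and of its translate by d that lie there have total
    measure above 3/2 l but are contained in an interval of length l + |d|, so
    they meet when |d| < l/2. *)
Lemma steinhaus (B : set R) : measurable (B : set (lebesgueR R)) ->
  0 < mu B < +oo ->
  exists2 e : R, (0 < e)%R & forall d : R, (`|d| < e)%R ->
    exists2 s, B s & B (s + d)%R.
Proof.
move=> mB /interval_of_high_density[a [b [ab dB]]].
exists ((b - a) / 2)%R; first by rewrite divr_gt0// subr_gt0.
set C := B `&` `]a, b]%classic in dB.
have mI x y : measurable (`]x, y]%classic : set (lebesgueR R)).
  exact: lebesgue_measurable_itv.
have mC : measurable (C : set (lebesgueR R)) by exact: measurableI.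
have pos d : (0 <= d < (b - a) / 2)%R -> exists2 s, B s & B (s + d)%R.
  move=> /andP[d0 dab]; apply: contrapT => nB.
  have mCd := measurable_shift d _ mC.
  set Cd := _ @^-1` C in mCd.
  have CCd : C `&` Cd = set0.
    by rewrite -subset0 => s [[Bs _] [Bsd _]]; apply: nB; exists s.
  have : mu (C `|` Cd) <= mu `](a - d)%R, b]%classic.
    apply: mu_le.
    by move=> s [[_]|[_]]; rewrite /= !in_itv/= => /andP[? ?];
      apply/andP; split; lra.
  have -> : mu (C `|` Cd) = mu C + mu C.
    by rewrite measureU//; congr (_ + _); exact: mu_shift.
  rewrite [leRHS]mu_itv/= lte_fin ifT; last by lra.
  apply/negP; rewrite -ltNge; apply: lt_le_trans (leeD (ltW dB) (ltW dB)).
  by rewrite -!EFinD lte_fin; lra.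
move=> d; rewrite ltr_norml => /andP[d1 d2]; have [d0|d0] := leP 0%R d.
  by apply: pos; rewrite d0.
have [|s Bs Bsd] := pos (- d)%R; first by apply/andP; split; lra.
by exists (s - d)%R => //; rewrite subrK.
Qed.

End LebesgueMeasure.

(** * Measurable semigroups of non-negative infinite matrices *)

(** A clock that counts the integers from 0 to v but stands still at those
    listed in L. In the climbing argument below, the listed levels are those of
    the finitely many states that are occupied most of the time. *)
Definition skip_count (L : seq nat) (v : nat) : nat :=
  \sum_(m < v) (val m \notin L).

Lemma skip_countS L v : skip_count L v.+1 = (skip_count L v + (v \notin L))%N.
Proof. by rewrite /skip_count big_ord_recr. Qed.

Lemma skip_count_mono L : {homo skip_count L : u v / (u <= v)%N}.
Proof.
move=> u v /subnK<-; elim: (v - u)%N => [|n IH]; first by rewrite add0n.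
by rewrite addSn skip_countS (leq_trans IH)// leq_addr.
Qed.

Lemma skip_count_le L v : (skip_count L v <= v)%N.
Proof.
elim: v => [|v IH]; first by rewrite /skip_count big_ord0.
by rewrite skip_countS -addn1 leq_add// leq_b1.
Qed.

Lemma skip_count_ge L v : (v <= skip_count L v + size L)%N.
Proof.
have -> : skip_count L v = count (fun m => m \notin L) (iota 0 v).
  elim: v => [|v IH]; first by rewrite /skip_count big_ord0.
  by rewrite skip_countS IH -addn1 iotaD count_cat /= addn0.
rewrite -{1}(size_iota 0 v) -(count_predC (fun m => m \notin L)) leq_add2l.
rewrite -size_filter uniq_leq_size ?filter_uniq ?iota_uniq// => m.
by rewrite mem_filter /= negbK => /andP[].
Qed.

(** The sums are taken in the extended reals, where a series of non-negative
    terms always has a value, so that the semigroup law includes the convergence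
    of its series. *)
Record matrix_semigroup (R : realType) (p : nat -> nat -> R -> R) : Prop := {
  msg_ge0 : forall i j t, 0 < t -> 0 <= p i j t;
  msg_add : forall i j s t, 0 < s -> 0 < t ->
    (p i j (s + t))%:E = (\sum_(k <oo) (p i k s * p k j t)%:E)%E;
  msg_meas : forall i j, lebesgue_measurable_fun `]0, +oo[ (p i j) }.

Section MatrixSemigroup.
Context {R : realType} (p : nat -> nat -> R -> R) (hp : matrix_semigroup R p).
Notation mu := (@completed_lebesgue_measure R).

Let pM_ge0 i k j s t : 0 < s -> 0 < t -> 0 <= p i k s * p k j t.
Proof. by move=> s0 t0; rewrite mulr_ge0// (msg_ge0 _ _ hp). Qed.

Lemma msg_term_le i k j s t : 0 < s -> 0 < t ->
  p i k s * p k j t <= p i j (s + t).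
Proof.
move=> s0 t0; rewrite -lee_fin (msg_add _ _ hp)//.
rewrite (nneseriesD1 (n := k))//; last by move=> l _; rewrite lee_fin pM_ge0.
by rewrite leeDl// nneseries_ge0// => l _ _; rewrite lee_fin pM_ge0.
Qed.

Lemma msg_gt0 i k j s t : 0 < s -> 0 < t ->
  0 < p i k s -> 0 < p k j t -> 0 < p i j (s + t).
Proof.
by move=> s0 t0 pi pj; apply: lt_le_trans (msg_term_le _ k _ _ _ s0 t0);
   rewrite mulr_gt0.
Qed.

Lemma msg_gt0_split i j s t : 0 < s -> 0 < t ->
  0 < p i j (s + t) -> exists k, 0 < p i k s /\ 0 < p k j t.
Proof.
move=> s0 t0; rewrite -lte_fin (msg_add _ _ hp)//.
apply: contraPP => /forallNP np; apply/negP; rewrite -leNgt eseries0// => k _ _.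
have /not_andP[/negP|/negP] := np k;
  rewrite lt_def (msg_ge0 _ _ hp)// andbT negbK.
  by move=> /eqP->; rewrite mul0r.
by move=> /eqP->; rewrite mulr0.
Qed.

Lemma measurable_msg i j tau :
  measurable_fun (`]0, tau[%classic : set (lebesgueR R))
    (p i j : lebesgueR R -> R).
Proof.
apply: (measurable_funS _ _ (msg_meas _ _ hp i j)).
  exact: lebesgue_measurable_itv.
by move=> x; rewrite /= !in_itv/= andbT => /andP[].
Qed.

Lemma measurable_msg_reflect i j tau :
  measurable_fun (`]0, tau[%classic : set (lebesgueR R))
    ((fun s => p i j (tau - s)) : lebesgueR R -> R).
Proof.
move=> mI Y mY.
have := measurable_reflect tau _ (measurable_msg i j tau mI Y mY).
congr measurable; apply/seteqP; split => x; rewrite /= !in_itv/=.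
  by move=> [/andP[? ?] ?]; split => //; apply/andP; split; lra.
by move=> [/andP[? ?] ?]; split => //; apply/andP; split; lra.
Qed.

Lemma measurable_passage i k j tau :
  measurable_fun (`]0, tau[%classic : set (lebesgueR R))
    ((fun s => p i k s * p k j (tau - s)) : lebesgueR R -> R).
Proof.
apply: measurable_funM; first exact: measurable_msg.
exact: measurable_msg_reflect.
Qed.

(** By the semigroup law every s in ]0, tau[ belongs to such a set B for some
    k, and countably many null sets cannot cover ]0, tau[. *)
Lemma intermediate_state i j tau : 0 < tau -> 0 < p i j tau ->
  exists k,
  let B :=
    [set s | 0 < s < tau /\ (0 < p i k s /\ 0 < p k j (tau - s))] in
  measurable (B : set (lebesgueR R)) /\ (0 < mu B < +oo)%E.
Proof.
move=> tau0 ptau.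
pose I : set (lebesgueR R) := `]0, tau[%classic.
have mI : measurable I by exact: lebesgue_measurable_itv.
have muI : mu I = tau%:E by rewrite [LHS]mu_itv/= lte_fin tau0 oppr0 adde0.
pose B k : set (lebesgueR R) :=
  [set s : R | 0 < s < tau /\ (0 < p i k s /\ 0 < p k j (tau - s))].
have mB k : measurable (B k).
  have := measurable_passage i k j tau mI _ (measurable_itv `]0, +oo[).
  congr measurable; apply/seteqP; split => s; rewrite /= !in_itv/= !andbT.
    move=> [/andP[s0 st]].
    have := msg_ge0 _ _ hp i k s s0.
    have ts : 0 < tau - s by rewrite subr_gt0.
    have := msg_ge0 _ _ hp k j _ ts.
    rewrite !le_eqVlt => /predU1P[<-|p1] /predU1P[<-|p2];
      rewrite ?(mulr0, mul0r, ltxx)// => _; split => //; exact/andP.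
  by move=> [s0 [p1 p2]]; split => //; rewrite mulr_gt0.
have Boo k : (mu (B k) < +oo)%E.
  apply: (@le_lt_trans _ _ (mu I)); last by rewrite muI ltry.
  by apply: mu_le => s [].
apply: contrapT => /forallNP nB.
have B0 k : mu (B k) = 0%E.
  apply/eqP; rewrite eq_le measure_ge0 andbT leNgt; apply/negP => Bk.
  apply: (nB k) => /=; split; first exact: mB.
  by apply/andP; split => //; exact: Boo.
suff : (mu I <= 0)%E by rewrite muI lee_fin leNgt tau0.
rewrite -[leRHS](@eseries0 R (fun k => mu (B k)) 0%N xpredT)//.
apply: (@le_trans _ _ (mu (\bigcup_k B k))); last first.
  exact: mu_bigcup_le.
apply: mu_le => s; rewrite /I/= in_itv/=.
move=> /andP[s0 st]; have ts : 0 < tau - s by rewrite subr_gt0.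
have [|k [p1 p2]] := msg_gt0_split i j s (tau - s) s0 ts.
  by rewrite addrC subrK.
by exists k => //; split => //; exact/andP.
Qed.

(** ** Positivity at arbitrarily small times *)

(** The product q k s is the weight of the paths that lead from i to j in time
    tau and are in state k at time s. For each s these weights add up to P, so
    q / P is a probability distribution on the states. *)
Section ArbitrarilyEarly.
Variables (i j : nat) (tau : R).
Hypotheses (tau0 : 0 < tau) (ptau : 0 < p i j tau).
Let P := p i j tau.
Let q k s := p i k s * p k j (tau - s).

Let q_ge0 k s : 0 < s < tau -> 0 <= q k s.
Proof.
by move=> /andP[s0 st]; rewrite mulr_ge0// (msg_ge0 _ _ hp)// subr_gt0.
Qed.

Let q_sum s : 0 < s < tau -> (\sum_(k <oo) (q k s)%:E = P%:E)%E.
Proof.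
move=> /andP[s0 st]; rewrite -(msg_add _ _ hp) ?subr_gt0//.
by rewrite addrC subrK.
Qed.

(** At every s the first kappa states carry almost all the weight once kappa is
    large. The exceptional sets U decrease to the empty set as kappa grows, so
    their measure tends to 0. *)
Lemma passage_tail_small (eta c : R) : 0 < eta -> 0 < c -> exists kappa : nat,
  let U := [set s | 0 < s < tau /\ \sum_(k < kappa) q k s < P - eta] in
  measurable (U : set (lebesgueR R)) /\ (mu U < c%:E)%E.
Proof.
move=> eta0 c0.
pose U n : set (lebesgueR R) :=
  [set s : R | 0 < s < tau /\ \sum_(k < n) q k s < P - eta].
pose I : set (lebesgueR R) := `]0, tau[%classic.
have mI : measurable I by exact: lebesgue_measurable_itv.
have mU n : measurable (U n).
  have mf : measurable_fun I ((fun s => \sum_(k < n) q k s) : lebesgueR R -> R).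
    by apply: measurable_sum => k; exact: measurable_passage.
  have := mf mI _ (measurable_itv `]-oo, P - eta[).
  by congr measurable; apply/seteqP; split => s; rewrite /= !in_itv/=.
have Uoo : (mu (U 0%N) < +oo)%E.
  apply: (@le_lt_trans _ _ (mu I)).
    by apply: mu_le => s []; rewrite /I/= in_itv.
  by rewrite [ltLHS]mu_itv/= lte_fin tau0 oppr0 adde0 ltry.
have Ucap : \bigcap_n U n = set0.
  rewrite -subset0 => s Us.
  have s0 : 0 < s < tau by have [] := Us 0%N Logic.I.
  suff : (P%:E <= (P - eta)%:E)%E by rewrite lee_fin; lra.
  rewrite -(q_sum s s0); apply: lime_le.
    by apply: is_cvg_nneseries => k _ _; rewrite lee_fin q_ge0.
  apply: nearW => n; rewrite big_mkord sumEFin lee_fin.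
  by apply/ltW; have [] := Us n Logic.I.
have mcap : measurable (\bigcap_n U n) by rewrite Ucap.
have Unoninc : nonincreasing_seq U.
  apply/nonincreasing_seqP => n; apply/subsetPset => s [s0 Us]; split => //.
  apply: le_lt_trans Us; rewrite big_ord_recr/= lerDl.
  exact: q_ge0.
have := nonincreasing_cvg_mu Uoo mU mcap Unoninc.
rewrite Ucap measure0 => /(_ _ (@nbhs_open_ereal_lt _ 0 (cst c) c0)).
by move=> [n _ Un]; exists n; split; [exact: mU|exact: (Un n (leqnn n))].
Qed.

Section Mesh.
Variables (h : R) (M kappa : nat).
Hypothesis h0 : 0 < h.

Let reach m k := `[< exists t, 0 < t <= m%:R * h /\ 0 < p i k t >].

(** The level lev k is, in units of the mesh width h, the first time at which k
    can be reached from i; it is capped at M, which keeps all the weighted sums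
    below finite. *)
Let lev k : nat := \sum_(m < M) ~~ reach m k.

Let lev_step k l d : 0 < d <= h -> 0 < p k l d -> (lev l <= (lev k).+1)%N.
Proof.
move=> /andP[d0 dh] pkl; rewrite /lev.
have reachS m : reach m k -> reach m.+1 l.
  move=> /asboolP[t [/andP[t0 tm] pt]]; apply/asboolP; exists (t + d).
  split; last by apply: (msg_gt0 _ k).
  by rewrite addr_gt0//= -natr1 mulrDl mul1r lerD.
case: M => [|M']; first by rewrite big_ord0.
rewrite big_ord_recl -[X in (_ <= X)%N]add1n leq_add ?leq_b1// big_ord_recr /=.
apply: leq_trans (leq_addr _ _); apply: leq_sum => m _.
rewrite /bump leq0n add1n.
by have := reachS m; case: (reach m k) => [->//|_]; exact: leq_b1.
Qed.

Let lev_start k s : 0 < s <= h -> 0 < p i k s -> (lev k <= 1)%N.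
Proof.
move=> /andP[s0 sh] pk; rewrite /lev.
case: M => [|M']; first by rewrite big_ord0.
rewrite big_ord_recl big1 ?addn0 ?leq_b1// => m _.
apply/eqP; rewrite eqb0 negbK; apply/asboolP; exists s; split => //.
rewrite s0 /= (le_trans sh)// ler_peMl ?(ltW h0)//.
by rewrite ler1n.
Qed.

Let L := [seq lev k | k <- iota 0 kappa].
Let psi k := skip_count L (lev k).

(** Along a step of length at most h the level rises by at most one, and by
    definition the clock psi does not see a rise that starts from the level of
    one of the first kappa states. *)
Let psi_step k l d : 0 < d <= h -> 0 < p k l d ->
  (psi l <= psi k + (kappa <= k))%N.
Proof.
move=> dh pkl; rewrite /psi.
apply: (@leq_trans (skip_count L (lev k).+1)).
  by apply: skip_count_mono; exact: lev_step pkl.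
rewrite skip_countS leq_add2l; have [_|kk] := leqP kappa k; first exact: leq_b1.
by rewrite leqn0 eqb0 negbK; apply: map_f; rewrite mem_iota.
Qed.

(** Up to the factor P, the expectation of psi at time s. *)
Let W s := (\sum_(k <oo) ((psi k)%:R * q k s)%:E)%E.

Let tail_le s : 0 < s < tau ->
  (\sum_(k <oo) ((kappa <= k)%N%:R * q k s)%:E <=
   (P - \sum_(k < kappa) q k s)%:E)%E.
Proof.
move=> s0; rewrite EFinB leeBrDr// -(q_sum s s0).
rewrite (@nneseries_split R _ 0 kappa); last first.
  by move=> k _; rewrite lee_fin mulr_ge0// q_ge0.
rewrite (@nneseries_split R (fun k => (q k s)%:E) 0 kappa); last first.
  by move=> k _; rewrite lee_fin q_ge0.
rewrite !add0n -sumEFin !big_mkord big1 ?add0e; last first.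
  by move=> k _; rewrite leqNgt ltn_ord mul0r.
rewrite addeC leeD2l//; apply: lee_nneseries => k _.
  by move=> _; rewrite lee_fin mulr_ge0// q_ge0.
by rewrite lee_fin ler_piMl ?q_ge0// lern1 leq_b1.
Qed.

Let W_step s d : 0 < s -> 0 < d <= h -> s + d < tau ->
  (W (s + d) <= W s + (P - \sum_(k < kappa) q k s)%:E)%E.
Proof.
move=> s0 /andP[d0 dh] sdt.
have st : 0 < s < tau by rewrite s0/=; lra.
have tsd : 0 < tau - (s + d) by rewrite subr_gt0.
apply: (@le_trans _ _ (W s + \sum_(k <oo) ((kappa <= k)%N%:R * q k s)%:E)%E);
  last by rewrite leeD2l// tail_le.
rewrite /W -nneseriesD; last 2 first.
- by move=> k _ _; rewrite lee_fin mulr_ge0// q_ge0.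
- by move=> k _ _; rewrite lee_fin mulr_ge0// q_ge0.
(* Weight of the passages through k at time s and through l at time s + d. *)
pose a l k := ((psi l)%:R * (p i k s * p k l d * p l j (tau - (s + d))))%:E.
have a0 l k : (0 <= a l k)%E.
  by rewrite lee_fin !mulr_ge0// (msg_ge0 _ _ hp).
have -> : (\sum_(l <oo) ((psi l)%:R * q l (s + d))%:E =
           \sum_(l <oo) \sum_(k <oo) a l k)%E.
  apply: eq_eseriesr => l _; rewrite /q mulrCA EFinM (msg_add _ _ hp)// muleC.
  rewrite -nneseriesZl; last first.
    by move=> k _; rewrite lee_fin mulr_ge0// (msg_ge0 _ _ hp).
  by apply: eq_eseriesr => k _; rewrite -EFinM; congr EFin; ring.
rewrite nneseries_interchange//; apply: lee_nneseries => k _.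
  by move=> _; apply: nneseries_ge0.
rewrite -EFinD -mulrDl /q.
have -> : tau - s = d + (tau - (s + d)) by ring.
rewrite EFinM [(p i k s * _)%:E]EFinM (msg_add _ _ hp)// muleA -EFinM.
rewrite -nneseriesZl; last first.
  by move=> l _; rewrite lee_fin mulr_ge0// (msg_ge0 _ _ hp).
apply: lee_nneseries => l _; first by move=> _; exact: a0.
rewrite -EFinM lee_fin.
have := msg_ge0 _ _ hp k l d d0; rewrite le_eqVlt => /predU1P[<-|pkl].
  by rewrite !(mul0r,mulr0).
rewrite -!mulrA ler_wpM2r//.
  by rewrite !mulr_ge0// (msg_ge0 _ _ hp).
by rewrite -natrD ler_nat; apply: (psi_step _ _ d) => //; exact/andP.
Qed.

Let W_start s : 0 < s <= h -> s < tau -> (W s <= P%:E)%E.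
Proof.
move=> sh st; have s0 : 0 < s < tau by case/andP: sh => -> _.
rewrite -(q_sum s s0); apply: lee_nneseries => k _.
  by move=> _; rewrite lee_fin mulr_ge0// q_ge0.
have := msg_ge0 _ _ hp i k s; case/andP: (s0) => s1 _ /(_ s1).
rewrite /q le_eqVlt => /predU1P[<-|pk]; first by rewrite mul0r mulr0.
rewrite lee_fin ler_piMl ?q_ge0// lern1.
exact: leq_trans (skip_count_le _ _) (lev_start _ _ sh pk).
Qed.

Let W_end s : 0 < s < tau -> tau - s <= h ->
  (((psi j)%:R * P)%:E <= W s + P%:E)%E.
Proof.
move=> s0 sh; rewrite -(q_sum s s0) -nneseriesD; last 2 first.
- by move=> k _ _; rewrite lee_fin mulr_ge0// q_ge0.
- by move=> k _ _; rewrite lee_fin q_ge0.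
rewrite EFinM -(q_sum s s0) -nneseriesZl; last first.
  by move=> k _; rewrite lee_fin q_ge0.
apply: lee_nneseries => k _.
  by move=> _; rewrite -EFinM lee_fin mulr_ge0// q_ge0.
rewrite -EFinM -EFinD lee_fin.
have st : 0 < tau - s by case/andP: s0 => _; rewrite subr_gt0.
have := msg_ge0 _ _ hp k j _ st; rewrite /q le_eqVlt => /predU1P[<-|pk].
  by rewrite !mulr0 addr0.
rewrite -[X in _ <= _ + X]mul1r -mulrDl ler_wpM2r ?q_ge0//.
rewrite natr1 ler_nat.
apply: leq_trans (psi_step k j _ _ pk) _; first by rewrite st.
by rewrite -addn1 leq_add2l leq_b1.
Qed.

(** A path that ends in j has climbed to level M if j cannot be reached before
    time M h. On the clock psi this is a rise of at least M - kappa, of which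
    the start and the end of the path contribute at most one unit each; every
    other unit comes from a mesh point at which the path is outside the first
    kappa states. Taking expectations gives the inequality. *)
Lemma mesh_inequality s n : 0 < s <= h ->
  s + n%:R * h < tau -> tau <= s + n.+1%:R * h ->
  (forall t, 0 < t <= M%:R * h -> p i j t <= 0) ->
  (M%:R - kappa%:R) * P <=
    2 * P + \sum_(m < n) (P - \sum_(k < kappa) q k (s + m%:R * h)).
Proof.
move=> sh snt tsn nreach.
have s0 : 0 < s by case/andP: sh.
have bound m : (m <= n)%N ->
    (W (s + m%:R * h) <=
     (P + \sum_(u < m) (P - \sum_(k < kappa) q k (s + u%:R * h)))%:E)%E.
  elim: m => [_|m IH mn].
    rewrite big_ord0 addr0 mul0r addr0; apply: W_start => //.
    by apply: le_lt_trans snt; rewrite lerDl mulr_ge0// ltW.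
  rewrite big_ord_recr/= addrA EFinD.
  apply: le_trans (leeD2r _ (IH (ltnW mn))).
  rewrite -natr1 mulrDl mul1r addrA; apply: W_step; rewrite ?h0 ?lexx//.
    by rewrite ltr_wpDr// mulr_ge0// ltW.
  apply: le_lt_trans snt; rewrite -addrA lerD2l.
  by rewrite -[X in _ + X]mul1r -mulrDl natr1 ler_wpM2r ?(ltW h0)// ler_nat.
have levj : lev j = M.
  rewrite /lev; under eq_bigr => m _.
    rewrite (_ : ~~ _ = true); last first.
      apply/asboolPn => -[t [/andP[t0 tm]]]; apply/negP.
      rewrite -leNgt nreach//.
      by rewrite t0 (le_trans tm)// ler_wpM2r ?(ltW h0)// ler_nat ltnW.
    over.
  by rewrite sum_nat_const card_ord muln1.
have Wn := W_end (s + n%:R * h).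
have : (psi j)%:R * P <=
    P + (P + \sum_(m < n) (P - \sum_(k < kappa) q k (s + m%:R * h))).
  rewrite -lee_fin [leRHS]EFinD addeC.
  apply: le_trans (leeD2r _ (bound n (leqnn n))); apply: Wn.
    by rewrite snt andbT ltr_wpDr// mulr_ge0// ltW.
  by move: tsn; rewrite -natr1 mulrDl mul1r; lra.
have twoP x : 2 * P + x = P + (P + x) by ring.
rewrite twoP => le1; apply: le_trans le1.
rewrite ler_wpM2r// ?(ltW ptau)// lerBlDr -natrD ler_nat.
by have := skip_count_ge L (lev j); rewrite size_map size_iota {1}levj.
Qed.

End Mesh.

(** If p i j vanished on ]0, e[, then by [mesh_inequality] the proportion of
    mesh points at which the path is outside the first kappa states would stay
    bounded below by about e / tau as the mesh gets finer. Averaging over the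
    offset of the mesh, the set of times at which these states carry too little
    weight would have a measure bounded below, against
    [passage_tail_small]. *)
Lemma gt0_arbitrarily_early e : 0 < e -> exists2 t, 0 < t < e & 0 < p i j t.
Proof.
move=> e0; apply: contrapT => nt.
have pe t : 0 < t < e -> p i j t <= 0.
  by move=> te; rewrite leNgt; apply/negP => pt; apply: nt; exists t.
(* Since tau / r < e, the width h = tau / (r M) below gives M h < e. *)
have [r r0 re] : exists2 r : nat, (0 < r)%N & tau < r%:R * e.
  exists (Num.bound (tau / e)).+1 => //; rewrite -ltr_pdivrMr//.
  apply: lt_trans (archi_boundP _) _; first by rewrite ltW// divr_gt0.
  by rewrite ltr_nat.
have r0' : 0 < r%:R :> R by rewrite ltr0n.
have [kappa /= [mU muU]] : exists kappa : nat,
  let U := [set s | 0 < s < tau /\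
    \sum_(k < kappa) q k s < P - P / (4 * r%:R)] in
  measurable (U : set (lebesgueR R)) /\ (mu U < (tau / (2 * r%:R))%:E)%E.
  by apply: passage_tail_small; rewrite divr_gt0// mulr_gt0.
set U := [set s | _] in mU muU.
(* With M = 4 (kappa + 3), the rise M - kappa - 2 of the clock exceeds the part
   M / 4 that the good mesh points can account for, thanks to the choice of the
   defect P / (4 r), by at least 2 (kappa + 3) = M / 2. *)
pose M := (4 * (kappa + 3))%N.
pose n := (r * M).-1.
have rM : (r * M)%N = n.+1 by rewrite prednK// muln_gt0 r0 /M; lia.
pose h := tau / (r * M)%:R.
have rM0 : 0 < (r * M)%:R :> R by rewrite ltr0n rM.
have h0 : 0 < h by rewrite divr_gt0.
have nh : n.+1%:R * h = tau by rewrite -rM /h mulrC divfK// gt_eqF.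
have M0 : 0 < M%:R :> R by rewrite ltr0n /M; lia.
have Mh : M%:R * h = tau / r%:R.
  by rewrite /h natrM; field; rewrite !gt_eqF.
have Mhe : M%:R * h < e by rewrite Mh ltr_pdivrMr// mulrC.
have : (((2 * (kappa + 3))%N%:R * h)%:E <= mu U)%E.
  apply: (mesh_count_le_measure U h n) => // s /andP[s0 sh].
  have nh' : n%:R * h + h = tau by rewrite -nh -natr1 mulrDl mul1r.
  have := mesh_inequality h M kappa h0 s n.
  rewrite s0 (ltW sh) /= -nh => /(_ isT).
  have -> : s + n%:R * h < n.+1%:R * h by rewrite nh -nh' addrC ltrD2l.
  have -> : n.+1%:R * h <= s + n.+1%:R * h by rewrite lerDr ltW.
  move=> /(_ isT isT) mi.
  have {mi}mi : (M%:R - kappa%:R) * P <= 2 * P +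
      \sum_(m < n) (P - \sum_(k < kappa) q k (s + m%:R * h)).
    by apply: mi => t /andP[t0 tM]; apply: pe; rewrite t0 (le_lt_trans tM).
  set c := (\sum_(m < n) _)%N.
  have le2 : \sum_(m < n) (P - \sum_(k < kappa) q k (s + m%:R * h)) <=
      n%:R * (P / (4 * r%:R)) + c%:R * P.
    rewrite /c natr_sum mulr_suml.
    rewrite mulr_natl -[X in _ *+ X]card_ord -sumr_const -big_split /=.
    apply: ler_sum => m _.
    have sm : 0 < s + m%:R * h < tau.
      have mn : m%:R * h <= n%:R * h.
        by rewrite ler_wpM2r ?(ltW h0)// ler_nat ltnW.
      apply/andP; split; first by rewrite ltr_wpDr// mulr_ge0// ltW.
      by rewrite -nh' addrC ler_ltD.
    have qq : 0 <= \sum_(k < kappa) q k (s + m%:R * h).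
      by apply: sumr_ge0 => k _; exact: q_ge0.
    have eta0 : 0 <= P / (4 * r%:R).
      by rewrite divr_ge0 ?(ltW ptau)// mulr_ge0// ler0n.
    have [_|] := boolP (_ \in U); first by rewrite mul1r; lra.
    rewrite notin_setE /U/= => /not_andP[//|/negP]; rewrite -leNgt mul0r.
    by lra.
  have nle : n%:R * (P / (4 * r%:R)) <= M%:R / 4 * P.
    apply: (@le_trans _ _ ((r * M)%:R * (P / (4 * r%:R)))).
      rewrite ler_wpM2r// ?ler_nat ?rM//.
      by rewrite divr_ge0 ?(ltW ptau)// mulr_ge0// ler0n.
    rewrite natrM le_eqVlt; apply/orP; left; apply/eqP.
    by field; rewrite gt_eqF.
  rewrite -(ler_nat R) -(ler_pM2r ptau) -/P.
  have : (M%:R - kappa%:R - 2 - M%:R / 4) * P <= c%:R * P by lra.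
  apply: le_trans; rewrite ler_pM2r// /M !natrM !natrD; lra.
apply/negP; rewrite -ltNge; apply: lt_le_trans muU _.
rewrite lee_fin (_ : tau / (2 * r%:R) = M%:R * h / 2); last first.
  by rewrite Mh invfM; ring.
by rewrite /M !natrM; lra.
Qed.

End ArbitrarilyEarly.

(** ** Recurrent intermediate states *)

(** If k cannot return to itself, a path visits k at most at one time, so the
    weights of the paths from r to j that are in k at the times x of a finite
    list add up to at most the weight of all paths. The induction cuts the paths
    at the first time of the list: those that are in k at that time do not visit
    k again, the others are covered by the induction hypothesis. *)
Lemma loopless_visits_le k : (forall d, 0 < d -> p k k d = 0) ->
  forall (s : seq R) r j tau, path <%R 0 s -> all (fun x => x < tau) s ->
    0 < tau ->
    \sum_(x <- s) p r k x * p k j (tau - x) <= p r j tau.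
Proof.
move=> pk0 s; move En : (size s) => n.
elim: n s En => [|n IH] [|x s]//= En r j tau.
  by rewrite big_nil => _ _ t0; exact: (msg_ge0 _ _ hp).
case: En => En /andP[x0 xs] /andP[xt st] tau0.
have xlt y : y \in s -> x < y.
  by apply/allP: y; exact: order_path_min lt_trans xs.
have ylt y : y \in s -> y < tau by apply/allP: y.
have tx : 0 < tau - x by rewrite subr_gt0.
(* For l = k the sum vanishes, since k does not return to itself. *)
have step l : (l == k)%:R * p k j (tau - x) +
    \sum_(y <- s) p l k (y - x) * p k j (tau - y) <= p l j (tau - x).
  have [->|lk] := eqVneq l k.
    rewrite mul1r big_seq big1 ?addr0// => y /xlt ys.
    by rewrite pk0 ?mul0r// subr_gt0.
  rewrite mul0r add0r.
  have := IH [seq y - x | y <- s]; rewrite size_map => /(_ En l j (tau - x)).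
  rewrite big_map; under eq_bigr do rewrite opprB addrA addrNK.
  apply => //.
    suff : path <%R (x - x) [seq y - x | y <- s] by rewrite subrr.
    have /= -> := @path_map _ _ (fun y => y - x) <%R x s.
    by rewrite (eq_path (e' := <%R))// => a b /=; rewrite ltrD2r.
  by rewrite all_map; apply/allP => y /ylt /=; rewrite ltrD2r.
rewrite big_cons -lee_fin.
have tauE : tau = x + (tau - x) by rewrite addrC subrK.
rewrite [in leRHS]tauE.
rewrite (msg_add _ _ hp)//.
have pge0 l y : y \in s -> 0 <= p r l x * (p l k (y - x) * p k j (tau - y)).
  move=> ys; rewrite !mulr_ge0// (msg_ge0 _ _ hp)// subr_gt0 ?xlt ?ylt//.
apply: (@le_trans _ _ (\sum_(l <oo)
  ((p r l x * ((l == k)%:R * p k j (tau - x)))%:E +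
   \sum_(y <- s | y \in s)
     (p r l x * (p l k (y - x) * p k j (tau - y)))%:E))%E); last first.
  apply: lee_nneseries => l _.
    move=> _; rewrite sumEFin -EFinD lee_fin addr_ge0//.
      by rewrite !mulr_ge0// (msg_ge0 _ _ hp).
    by apply: sumr_ge0 => y; exact: pge0.
  rewrite sumEFin -EFinD lee_fin -mulr_sumr -mulrDr ler_wpM2l//.
    exact: (msg_ge0 _ _ hp).
  by rewrite -big_seq.
rewrite nneseriesD//; last 2 first.
- by move=> l _ _; rewrite lee_fin !mulr_ge0// (msg_ge0 _ _ hp).
- by move=> l _ _; apply: sume_ge0 => y ys; rewrite lee_fin pge0.
rewrite nneseries_sum; last by move=> y l ys; rewrite lee_fin pge0.
rewrite EFinD leeD//.
  rewrite (nneseriesD1 (n := k))//; last first.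
    by move=> l _; rewrite lee_fin !mulr_ge0// (msg_ge0 _ _ hp).
  rewrite eqxx mul1r leeDl// nneseries_ge0// => l _ _.
  by rewrite lee_fin !mulr_ge0// (msg_ge0 _ _ hp).
rewrite big_seq -sumEFin; apply: lee_sum => y ys.
have yx : 0 < y - x by rewrite subr_gt0 xlt.
have yE : y = x + (y - x) by rewrite addrC subrK.
rewrite [X in p r k X]yE EFinM (msg_add _ _ hp)// muleC.
rewrite -nneseriesZl; last by move=> l _; rewrite lee_fin pM_ge0.
apply: lee_nneseries => l _.
  move=> _; rewrite -EFinM lee_fin !mulr_ge0// (msg_ge0 _ _ hp)//.
  by rewrite subr_gt0 ylt.
by rewrite -EFinM lee_fin mulrC mulrA.
Qed.

(** The weights of the visits to k at finitely many times have a bounded sum, so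
    only finitely many of them exceed a given positive number. *)
Lemma loopless_passage_countable k : (forall d, 0 < d -> p k k d = 0) ->
  forall i j tau, 0 < tau ->
  countable [set s | 0 < s < tau /\ (0 < p i k s /\ 0 < p k j (tau - s))].
Proof.
move=> pk0 i j tau tau0.
pose B n := [set s | 0 < s < tau /\ n.+1%:R^-1 <= p i k s * p k j (tau - s)].
suff fB n : finite_set (B n).
  apply: (@sub_countable _ _ _ (\bigcup_n B n)); last first.
    apply: bigcup_countable => [|n _]; first exact: countableP.
    exact: finite_set_countable.
  apply: subset_card_le => s [s0 [p1 p2]].
  have q0 : 0 < p i k s * p k j (tau - s) by rewrite mulr_gt0.
  have [n _ nq] := near_infty_natSinv_lt (PosNum q0).
  by exists n => //; split => //; apply/ltW; exact: (nq n (leqnn n)).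
apply: contrapT => infB.
set P := p i j tau.
have [N NP] : exists N : nat, P * n.+1%:R < N%:R.
  exists (Num.bound (P * n.+1%:R)); apply: archi_boundP.
  by rewrite mulr_ge0// (msg_ge0 _ _ hp).
have [A AB NA] := infinite_set_fset N infB.
pose s := sort <=%R (enum_fset A).
have sB x : x \in s -> B n x by rewrite mem_sort => xA; exact: AB.
have sl : sorted <%R s by rewrite sort_lt_sorted; exact: fset_uniq.
have path0 : path <%R 0 s.
  case: (s) sl sB => //= x s' -> /(_ x).
  by rewrite mem_head => /(_ isT) [/andP[-> _] _].
have all0 : all (fun x => x < tau) s.
  by apply/allP => x /sB[/andP[]].
have := loopless_visits_le k pk0 s i j tau path0 all0 tau0.
apply/negP; rewrite -ltNge.
apply: (@lt_le_trans _ _ (\sum_(x <- s) n.+1%:R^-1)); last first.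
  by rewrite big_seq [leRHS]big_seq; apply: ler_sum => x /sB[].
rewrite big_const_seq count_predT iter_addr_0 size_sort -[ltRHS]mulr_natl.
rewrite ltr_pdivlMr//; apply: lt_le_trans NP _.
by rewrite ler_nat.
Qed.

(** The state k found by [intermediate_state] is visited at a non-null set of
    times, hence at uncountably many, so it has to return to itself. *)
Lemma recurrent_intermediate_state i j tau : 0 < tau -> 0 < p i j tau ->
  exists k s d, [/\ 0 < s < tau, 0 < p i k s, 0 < p k j (tau - s),
    0 < d & 0 < p k k d].
Proof.
move=> tau0 ptau.
have [k /= [mB /andP[B0 _]]] := intermediate_state i j tau tau0 ptau.
set B := [set s | _] in mB B0.
have [s [s0 [p1 p2]]] : exists s, B s.
  apply: contrapT => /forallNP nB; move: B0.
  rewrite (_ : B = set0) ?measure0 ?ltxx//.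
  by rewrite -subset0 => s /nB.
suff [d [d0 pd]] : exists d, 0 < d /\ 0 < p k k d by exists k, s, d.
apply: contrapT => /forallNP np.
have pk0 d : 0 < d -> p k k d = 0.
  move=> d0; apply/eqP; rewrite eq_le (msg_ge0 _ _ hp)// andbT leNgt.
  by apply/negP => ?; apply: (np d).
have /countable_mu0 muB := loopless_passage_countable k pk0 i j tau tau0.
by move: B0; rewrite /B muB ltxx.
Qed.

Lemma loop_gt0_add_muln i (d : R) n t : 0 < d -> 0 < t ->
  0 < p i i d -> 0 < p i i t -> 0 < p i i (t + n%:R * d).
Proof.
move=> d0 t0 pd pt; elim: n => [|n IH]; first by rewrite mul0r addr0.
rewrite -natr1 mulrDl mul1r addrA; apply: (msg_gt0 _ i) => //.
by rewrite ltr_wpDr// mulr_ge0// ltW.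
Qed.

(** Splitting a short loop of duration tau at a state l, which can be done at
    all times of a non-null set, Steinhaus' theorem yields loops of every
    duration close to tau. Adding multiples of the duration of a loop that is
    shorter than this range of durations reaches every t > tau. *)
Lemma loop_gt0 k d : 0 < d -> 0 < p k k d -> forall t, 0 < t -> 0 < p k k t.
Proof.
move=> d0 pd t t0.
have [tau /andP[tau0 taut] ptau] := gt0_arbitrarily_early k k d d0 pd t t0.
have [l /= [mB muB]] := intermediate_state k k tau tau0 ptau.
have [e e0 He] := steinhaus _ mB muB.
have [dd /andP[dd0 dde] pdd] := gt0_arbitrarily_early k k d d0 pd e e0.
have t1 : 0 <= t - tau by rewrite subr_ge0 ltW.
(* t is tau + r plus n loops of duration dd, with 0 <= r < dd < e. *)
pose n := Num.truncn ((t - tau) / dd).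
have /andP[n1 n2] := truncn_itv (divr_ge0 t1 (ltW dd0)); rewrite -/n in n1 n2.
rewrite ler_pdivlMr// in n1; rewrite ltr_pdivrMr// in n2.
pose r := t - tau - n%:R * dd.
have re : `|r| < e.
  rewrite ger0_norm ?subr_ge0//; apply: lt_trans dde.
  by move: n2; rewrite /r -natr1 mulrDl mul1r; lra.
have [s [/andP[s0 st] [p1 p2]] [/andP[sr0 srt] [p3 p4]]] := He r re.
have -> : t = ((s + r) + (tau - s)) + n%:R * dd by rewrite /r; ring.
apply: loop_gt0_add_muln => //; first by rewrite addr_gt0// subr_gt0.
by apply: (msg_gt0 _ l); rewrite ?subr_gt0.
Qed.

Lemma matrix_semigroup_dichotomy i j tau : 0 < tau -> 0 < p i j tau ->
  forall t, 0 < t -> 0 < p i j t.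
Proof.
move=> tau0 ptau t t0.
(* i -> k in time s, loops at k for time t - x, k -> j in time x - s *)
have [x /andP[x0 xt] px] := gt0_arbitrarily_early i j tau tau0 ptau t t0.
have [k [s [d [/andP[s0 sx] p1 p2 d0 pd]]]] :=
  recurrent_intermediate_state i j x x0 px.
have -> : t = s + (t - x) + (x - s) by ring.
apply: (msg_gt0 _ k); rewrite ?subr_gt0//.
  by rewrite ltr_pDl// subr_gt0.
apply: (msg_gt0 _ k); rewrite ?subr_gt0//.
by apply: (loop_gt0 k d); rewrite ?subr_gt0.
Qed.

End MatrixSemigroup.

(** * Positive operators on sequence spaces *)

Section SeqSpace.
Variables (R : realType) (S : {pred nat -> R}) (hS : sequence_space S)
  (E : banachSeqType S).
Hypotheses (hlat : lattice_norm E) (hoc : order_continuous_norm E).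
Implicit Types x y : E.
Notation e := (seq_unit E hS).

Lemma seq_coordD x y n : seq_coord (x + y) n = seq_coord x n + seq_coord y n.
Proof. by rewrite /seq_coord raddfD. Qed.

Lemma seq_coordB x y n : seq_coord (x - y) n = seq_coord x n - seq_coord y n.
Proof. by rewrite /seq_coord raddfB. Qed.

Lemma seq_coordZ c x n : seq_coord (c *: x) n = c * seq_coord x n.
Proof. by rewrite /seq_coord linearZ. Qed.

Lemma seq_coord0 n : seq_coord (0 : E) n = 0.
Proof. by rewrite /seq_coord raddf0. Qed.

Lemma seq_coord_sum I (r : seq I) (F : I -> E) n :
  seq_coord (\sum_(k <- r) F k) n = \sum_(k <- r) seq_coord (F k) n.
Proof.
by elim/big_rec2: _ => [|k a b _ <-]; rewrite ?seq_coord0// seq_coordD.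
Qed.

Lemma seq_coord_unit k n : seq_coord (e k) n = (n == k)%:R.
Proof. by rewrite /seq_coord /seq_unit SubK. Qed.

(** The vector |y_n| e_n lies below |y|. *)
Lemma seq_coord_le_norm n : exists2 C : R, 0 < C &
  forall y, `|seq_coord y n| <= C * `|y|.
Proof.
have en0 : 0 < `|e n|.
  rewrite normr_gt0; apply/negP => /eqP en.
  have := seq_coord_unit n n; rewrite en seq_coord0 eqxx => /eqP.
  by rewrite eq_sym oner_eq0.
exists `|e n|^-1; first by rewrite invr_gt0.
move=> y; rewrite mulrC ler_pdivlMr// -normrZ; apply: hlat => m.
rewrite seq_coordZ seq_coord_unit; have [->|_] := eqVneq m n.
  by rewrite mulr1.
by rewrite mulr0 normr0.
Qed.

Lemma cvg_seq_coord (u : nat -> E) (l : E) n :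
  u @ \oo --> l -> (fun k => seq_coord (u k) n) @ \oo --> seq_coord l n.
Proof.
move=> ul; have [C C0 HC] := seq_coord_le_norm n.
apply/cvgrPdist_le => eps eps0.
have epsC : 0 < eps / C by rewrite divr_gt0.
have /cvgrPdist_le/(_ _ epsC) := ul; apply: filterS => k kl.
rewrite -seq_coordB; apply: le_trans (HC _) _.
by rewrite mulrC -ler_pdivlMr.
Qed.

(** The partial sums are dominated by x and converge to x coordinatewise, so
    order continuity of the norm applies. *)
Lemma seq_coord_head_cvg x : (forall n, 0 <= seq_coord x n) ->
  (fun n => \sum_(k < n) seq_coord x k *: e k) @ \oo --> x.
Proof.
move=> x0; have coord n m : seq_coord (\sum_(k < n) seq_coord x k *: e k) m =
    if (m < n)%N then seq_coord x m else 0.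
  rewrite -(big_mkord xpredT (fun k => seq_coord x k *: e k)) seq_coord_sum.
  under eq_bigr do rewrite seq_coordZ seq_coord_unit.
  elim: n => [|n IH]; first by rewrite big_nil.
  rewrite big_nat_recr//= IH; have [->|mn] := eqVneq m n.
    by rewrite ltnn ltnSn mulr1 add0r.
  by rewrite mulr0 addr0 [in RHS]ltnS [in RHS]leq_eqVlt (negbTE mn).
apply: hoc; split.
  exists x => n m; rewrite coord; case: ifP => _; last by rewrite normr0.
  by rewrite ger0_norm.
move=> m; apply/cvgrPdist_le => eps eps0; exists m.+1 => // n /= mn.
by rewrite coord mn subrr normr0 ltW.
Qed.

Section Positive.
Variable T : {linear E -> E}.
Hypothesis Tpos : positive_operator T.

Lemma positive_le x y n : (forall m, seq_coord x m <= seq_coord y m) ->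
  seq_coord (T x) n <= seq_coord (T y) n.
Proof.
move=> xy; rewrite -subr_ge0 -seq_coordB -raddfB; apply: Tpos => m.
by rewrite seq_coordB subr_ge0.
Qed.

(** The argument by which positive operators on Banach lattices are
    automatically bounded. If the coordinates of the T (r k) stayed above c > 0,
    a subsequence of r with summable norms would have a sum y in E, and
    positivity would force (T y) j >= M c for every M. *)
Lemma positive_sigma_continuous (r : nat -> E) j :
  (forall k n, 0 <= seq_coord (r k) n) ->
  (forall k n, seq_coord (r k.+1) n <= seq_coord (r k) n) ->
  r @ \oo --> (0 : E) -> (fun k => seq_coord (T (r k)) j) @ \oo --> (0 : R).
Proof.
move=> r0 rS rcvg.
have rmono k l n : (k <= l)%N -> seq_coord (r l) n <= seq_coord (r k) n.
  move=> /subnK<-; elim: (l - k)%N => [|m IH]; first by rewrite add0n.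
  by rewrite addSn (le_trans (rS _ _)).
suff Hc c : 0 < c -> exists k, seq_coord (T (r k)) j < c.
  apply/cvgrPdist_le => c c0; have [k kc] := Hc c c0.
  exists k => // l /= kl; rewrite sub0r normrN ger0_norm; last exact: Tpos.
  by apply: le_trans (ltW kc); apply: positive_le => n; exact: rmono.
move=> c0; apply: contrapT => /forallNP nc.
have Tc k : c <= seq_coord (T (r k)) j.
  by rewrite leNgt; apply/negP => ?; exact: (nc k).
have /choice[f Hf] : forall m : nat, exists k : nat, `|r k| <= 2^-1 ^+ m.
  move=> m; have pm : 0 < 2^-1 ^+ m :> R by rewrite exprn_gt0.
  have /cvgrPdist_le/(_ _ pm)[k _ /(_ k (leqnn k))] := rcvg.
  by rewrite sub0r normrN; exists k.
have cy : cvgn (series (fun m => r (f m))).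
  apply: normed_cvg; apply: (@series_le_cvg _ _ (geometric 1 2^-1)).
  - by move=> m; exact: normr_ge0.
  - by move=> m; rewrite /geometric/= mul1r exprn_ge0.
  - by move=> m; rewrite /geometric/= mul1r; exact: Hf.
  - apply: is_cvg_geometric_series; rewrite ger0_norm ?invr_ge0//.
    by rewrite invf_lt1// ltr1n.
set y := limn (series (fun m => r (f m))) in cy.
have yge M n : seq_coord (series (fun m => r (f m)) M) n <= seq_coord y n.
  have cc := cvg_seq_coord _ _ n cy.
  rewrite -(cvg_lim (@Rhausdorff R) cc); apply: limr_ge.
    by apply/cvg_ex; eexists; exact: cc.
  exists M => // N /= /subnK<-.
  elim: (N - M)%N => [|k IH]; first by rewrite add0n.
  apply: le_trans IH _; rewrite addSn /series/= big_nat_recr//= seq_coordD.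
  by rewrite lerDl.
have bound M : M%:R * c <= seq_coord (T y) j.
  apply: le_trans (positive_le _ _ j (yge M)).
  rewrite /series/= raddf_sum seq_coord_sum.
  rewrite -[M in leLHS]subn0 mulr_natl -sumr_const_nat.
  by apply: ler_sum => m _; exact: Tc.
have Ty0 : 0 <= seq_coord (T y) j by have := bound 0%N; rewrite mul0r.
have := bound (Num.bound (seq_coord (T y) j / c)); apply/negP; rewrite -ltNge.
by rewrite -ltr_pdivrMr// archi_boundP// divr_ge0// ltW.
Qed.

Lemma positive_coord_sum x j : (forall n, 0 <= seq_coord x n) ->
  (fun n => \sum_(k < n) seq_coord x k * seq_coord (T (e k)) j) @ \oo -->
  seq_coord (T x) j.
Proof.
move=> x0.
pose r n := x - \sum_(k < n) seq_coord x k *: e k.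
have rS n : r n = r n.+1 + seq_coord x n *: e n.
  by rewrite /r big_ord_recr/= opprD addrA subrK.
have re n m : seq_coord (r n) m = if (m < n)%N then 0 else seq_coord x m.
  elim: n => [|n IH]; first by rewrite /r big_ord0 subr0.
  have : seq_coord (r n.+1) m = seq_coord (r n) m - seq_coord x n * (m == n)%:R.
    by rewrite (rS n) seq_coordD seq_coordZ seq_coord_unit addrK.
  move=> ->; rewrite IH [in RHS]ltnS [in RHS]leq_eqVlt.
  have [->|mn] := eqVneq m n.
    by rewrite ltnn mulr1 subrr.
  by rewrite mulr0 subr0.
have Tr n : seq_coord (T (r n)) j =
    seq_coord (T x) j - \sum_(k < n) seq_coord x k * seq_coord (T (e k)) j.
  rewrite /r raddfB seq_coordB raddf_sum seq_coord_sum; congr (_ - _).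
  apply: eq_bigr => k _; rewrite -seq_coordZ; congr (seq_coord _ j).
  exact: linearZZ.
have : (fun n => seq_coord (T (r n)) j) @ \oo --> (0 : R).
  apply: positive_sigma_continuous => [n m|n m|].
  - by rewrite re; case: ifP.
  - rewrite !re; case: ifP => [mn|]; first by case: ifP.
    by move=> /negbT; rewrite -leqNgt => /ltnW; rewrite ltnNge => ->.
  - rewrite -[X in _ --> X](subrr x); apply: cvgB; first exact: cvg_cst.
    exact: seq_coord_head_cvg.
under eq_fun do rewrite Tr.
move=> /cvgrPdist_le H; apply/cvgrPdist_le => eps eps0.
by apply: filterS (H eps eps0) => n; rewrite sub0r normrN.
Qed.

End Positive.

(** The product formula for matrices is the expansion of T_s e_i along the unit
    vectors, to which T_t can be applied term by term. *)
Lemma semigroup_matrix (T : R -> {linear E -> E}) : positive_semigroup T ->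
  (forall i j : nat,
    lebesgue_measurable_fun `]0, +oo[ (fun t => seq_coord (T t (e i)) j)) ->
  matrix_semigroup R (fun i j t => seq_coord (T t (e i)) j).
Proof.
move=> [Tadd Tpos] meas.
have e0 i n : 0 <= seq_coord (e i) n by rewrite seq_coord_unit.
split=> // [i j t t0|i j s t s0 t0]; first exact: Tpos.
rewrite addrC Tadd//=.
apply/esym/cvg_lim => //.
rewrite (_ : (fun n => _) = EFin \o (fun n => \sum_(k < n)
    seq_coord (T s (e i)) k * seq_coord (T t (e k)) j)); last first.
  by apply/funext => n; rewrite big_mkord/= sumEFin.
apply: cvg_EFin; first by apply: nearW.
by apply: positive_coord_sum => [|n]; apply: Tpos.
Qed.

End SeqSpace.

Theorem corollary1p3 (R : realType) (S : {pred nat -> R})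
    (hS : sequence_space S) (E : banachSeqType S)
    (hlat : lattice_norm E) (hoc : order_continuous_norm E)
    (T : R -> {linear E -> E}) (hT : positive_semigroup T)
    (hmeas : forall i j : nat,
      lebesgue_measurable_fun `]0, +oo[ (fun t => seq_coord (T t (seq_unit E hS i)) j)) :
  forall i j : nat,
    (forall t : R, 0 < t -> 0 < seq_coord (T t (seq_unit E hS i)) j) \/
    (forall t : R, 0 < t -> seq_coord (T t (seq_unit E hS i)) j = 0).
Proof.
move=> i j; have hp := semigroup_matrix R S hS E hlat hoc T hT hmeas.
have [[tau tau0 ptau]|np] := pselect (exists2 tau : R, 0 < tau &
    0 < seq_coord (T tau (seq_unit E hS i)) j).
  by left; apply: (matrix_semigroup_dichotomy _ hp i j tau).
right=> t t0; apply/eqP; rewrite eq_le (msg_ge0 _ _ hp)// andbT leNgt.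
by apply/negP => pt; apply: np; exists t.
Qed.
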